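(* Let $s,t,v\ge 0$ be integers exactly one of which is zero, and let $\omega=s+t+v$. Any storage-balanced schedule, on the $p$-processor parallel machine, of any execution DAG of the direct evaluation algorithm $\Psi^{(s,t,v)}$ for symmetric tensor contractions of dimension $n$ has horizontal communication cost $$W_\Psi(n,s,t,v,p)=\Omega\!\left(\left(\frac{n^{\omega}}{p}\right)^{\max(s,t,v)/\omega}\right).$$
   Context: Asymptotics. $n$ and $p$ are asymptotic parameters and $s,t,v$ are constants: $W=\Omega(f(n,p))$ means that there are constants $\gamma>0,n_0,p_0$ depending only on $s,t,v$ such that $W\ge\gamma f(n,p)$ for every schedule of the stated type, for all $n\ge n_0$, $p\ge p_0$ satisfying the divisibility assumption below. Bilinear algorithm. A bilinear algorithm is a triple of real matrices $(F^{(A)},F^{(B)},F^{(C)})$ with the same number of columns. On input vectors $a,b$ it computes $c=F^{(C)}\big[((F^{(A)})^{\mathsf T}a)\odot((F^{(B)})^{\mathsf T}b)\big]$, $\odot$ being the entrywise product. Its rank is the number of columns. Tuples. Let $I_n^d=\{(i_1,\dots,i_d)\in\{1,\dots,n\}^d: i_1\le\dots\le i_d\}$, so $|I_n^d|=\binom{n+d-1}{d}$. For a tuple $k$ of length $q+r$, $\chi^q_r(k)$ is the collection of all pairs of tuples of lengths $q$ and $r$ obtained by choosing $q$ positions of $k$, listing the entries at these positions in order, and listing the remaining entries in order. For a tuple $k$ of length $v$, $\rho(k)=v!/\prod_i m_i!$ where $m_i$ are the multiplicities of the distinct values of $k$. Direct evaluation algorithm $\Psi^{(s,t,v)}$. It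 computes the symmetrized contraction over $v$ indices of a symmetric tensor $A$ of order $s+v$ with a symmetric tensor $B$ of order $v+t$ into a symmetric tensor $C$ of order $s+t$, all dimensions $n$, storing only entries with nondecreasing index tuples. As a bilinear algorithm: rows of $F^{(A)},F^{(B)},F^{(C)}$ are indexed by $I_n^{s+v},I_n^{v+t},I_n^{s+t}$ respectively (so $a,b,c$ are the unique entries of $A,B,C$), columns by triples $(j,l,k)\in I_n^s\times I_n^t\times I_n^v$. The only nonzeros are: $F^{(A)}_{g,(j,l,k)}=1$ if $(j,k)\in\chi^s_v(g)$; $F^{(B)}_{h,(j,l,k)}=1$ if $(k,l)\in\chi^v_t(h)$; $F^{(C)}_{i,(j,l,k)}=s!\,t!\,\rho(k)$ if $(j,l)\in\chi^s_t(i)$. Execution DAG. An execution DAG of a bilinear algorithm is a directed acyclic graph $G=(V,E)$ in which each vertex has in-degree $0$ (an input value, i.e. an entry of $a$ or $b$) or in-degree $2$ (the result of a weighted addition or of a multiplication of its two predecessors). $V$ is a disjoint union $V^{(A)}\cup V^{(B)}\cup V^{(C)}$: vertices of $V^{(A)}$ (resp. $V^{(B)}$) are linear combinations of entries of $a$ (resp. $b$), vertices of $V^{(C)}$ are the computed products and linear combinations of products; $V^{(M)}\subseteq V^{(C)}$ is the set of computed products, one for each column. The outputs (entries of $c$) are vertices of $V^{(C)}$. Edges go within $V^{(A)}$, within $V^{(B)}$ (these compute, by additions, the operands of the products), from $V^{(A)}$ to $V^{(M)}$ and from $V^{(B)}$ to $V^{(M)}$ (each product has exactly one operand from each), and from $V^{(C)}$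 to $V^{(C)}\setminus V^{(M)}$ (summations computing the outputs as prescribed by $F^{(C)}$). Parallel machine with $p$ processors. The processors have a fully connected network and exchange elements (vertex values) by point-to-point messages. A parallel schedule of an execution DAG assigns each non-input vertex to exactly one processor, which computes it (no recomputation); operands must be present on that processor, either because it initially owned them, computed them, or received them. Each input element is on exactly one processor at the start. The horizontal communication cost $W$ is the largest, over processors, total number of elements sent and received by that processor. A schedule is storage-balanced if at the start each processor owns exactly a $1/p$ fraction of the entries of each of $a$ and $b$, and at the end each processor owns exactly a $1/p$ fraction of the entries of $c$, each output entry being on a unique processor. It is assumed that $p$ divides the number of entries of each of $a,b,c$ and the number of products (columns). *)

(* Defs.v *)
From HB Require Import structures.
From mathcomp Require Import all_boot all_order all_algebra.
From mathcomp Require Import reals exp.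

Set Implicit Arguments.
Unset Strict Implicit.
Unset Printing Implicit Defensive.

Import Order.TTheory GRing.Theory Num.Theory.
Local Open Scope ring_scope.

(** * Bilinear algorithms *)

Record bilinear_alg (R : realType) (ma mb mc r : nat) := BilinearAlg {
  FA : 'M[R]_(ma, r);
  FB : 'M[R]_(mb, r);
  FC : 'M[R]_(mc, r)
}.

Definition bilinear_eval (R : realType) (ma mb mc r : nat)
    (alg : bilinear_alg R ma mb mc r) (a : 'cV[R]_ma) (b : 'cV[R]_mb) :
    'cV[R]_mc :=
  FC alg *m map2_mx *%R ((FA alg)^T *m a) ((FB alg)^T *m b).

(** * Direct evaluation of a symmetrized contraction *)

(* Indices range over 0, ..., n-1 instead of 1, ..., n. *)
Definition sym_index (n d : nat) : finType :=
  {t : d.-tuple 'I_n | sorted leq [seq val i | i <- t]}.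

(* The mask [m] marks the chosen positions; that there are [q] of them is
   forced by the length of [xy.1]. *)
Definition chi (T : finType) (q r : nat) (k : (q + r).-tuple T) :
    {set q.-tuple T * r.-tuple T} :=
  [set xy : q.-tuple T * r.-tuple T | [exists m : (q + r).-tuple bool,
     (mask m k == xy.1 :> seq T) &&
     (mask [seq ~~ b | b <- m] k == xy.2 :> seq T)]].

Definition rho (R : realType) (n v : nat) (k : v.-tuple 'I_n) : R :=
  v`!%:R / (\prod_(x < n) (count_mem x k)`!)%:R.

Definition col_index (n s t v : nat) : finType :=
  (sym_index n s * sym_index n t * sym_index n v)%type.

(* MathComp matrices are indexed by ordinals: rows and columns are numbered
   through the enumerations of [sym_index] and [col_index]. *)
Definition Psi (R : realType) (n s t v : nat) :
    bilinear_alg R #|sym_index n (s + v)| #|sym_index n (v + t)|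
                   #|sym_index n (s + t)| #|col_index n s t v| :=
  BilinearAlg
    (\matrix_(g, c) let: (j, l, k) := enum_val c in
       ((val j, val k) \in chi (val (enum_val g)))%:R)
    (\matrix_(h, c) let: (j, l, k) := enum_val c in
       ((val k, val l) \in chi (val (enum_val h)))%:R)
    (\matrix_(i, c) let: (j, l, k) := enum_val c in
       if (val j, val l) \in chi (val (enum_val i))
       then s`!%:R * t`!%:R * rho R (val k) else 0).

(** * Execution DAGs *)

(* [lcA x], [lcB x] and [lcC x] are meaningful for [x] in [VA], [VB] and [VC]
   respectively: they are the coefficients of the value at [x] on the entries
   of [a], on the entries of [b] and on the computed products.  They are
   determined by the edge weights [wt], which are arbitrary reals. *)
Record exec_dag (R : realType) (ma mb mc r : nat)
    (alg : bilinear_alg R ma mb mc r) := ExecDag {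
  vertex :> finType;
  edge : rel vertex;
  wt : vertex -> vertex -> R;
  VA : {set vertex};
  VB : {set vertex};
  VC : {set vertex};
  inA : 'I_ma -> vertex;
  inB : 'I_mb -> vertex;
  prd : 'I_r -> vertex;
  out : 'I_mc -> vertex;
  lcA : vertex -> 'cV[R]_ma;
  lcB : vertex -> 'cV[R]_mb;
  lcC : vertex -> 'rV[R]_r;
  VM : {set vertex} := [set prd c | c : 'I_r];

  edge_acyclic : forall x y, edge x y -> ~~ connect edge y x;
  VABC_cover : VA :|: VB :|: VC = setT;
  VAB_disj : [disjoint VA & VB];
  VAC_disj : [disjoint VA & VC];
  VBC_disj : [disjoint VB & VC];
  inA_inj : injective inA;
  inB_inj : injective inB;
  prd_inj : injective prd;
  inA_VA : forall i, inA i \in VA;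
  inB_VB : forall i, inB i \in VB;
  prd_VC : forall c, prd c \in VC;
  out_VC : forall i, out i \in VC;

  indegree : forall x, (#|[set y | edge y x]| == 0)%N
                       || (#|[set y | edge y x]| == 2)%N;
  indegree0 : forall x, (#|[set y | edge y x]| == 0)%N
                        = (x \in codom inA) || (x \in codom inB);
  edge_type : forall x y, edge x y ->
    [|| (x \in VA) && (y \in VA),
        (x \in VB) && (y \in VB),
        (x \in VA) && (y \in VM),
        (x \in VB) && (y \in VM)
      | (x \in VC) && (y \in VC :\: VM)];

  lcA_in : forall i, lcA (inA i) = delta_mx i 0;
  lcB_in : forall i, lcB (inB i) = delta_mx i 0;
  lcC_prd : forall c, lcC (prd c) = delta_mx 0 c;
  lcA_add : forall x, x \in VA -> x \notin codom inA ->
    lcA x = \sum_(y | edge y x) wt y x *: lcA y;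
  lcB_add : forall x, x \in VB -> x \notin codom inB ->
    lcB x = \sum_(y | edge y x) wt y x *: lcB y;
  lcC_add : forall x, x \in VC -> x \notin VM ->
    lcC x = \sum_(y | edge y x) wt y x *: lcC y;

  prd_opA : forall c, #|[set x in VA | edge x (prd c)]| = 1%N;
  prd_opB : forall c, #|[set x in VB | edge x (prd c)]| = 1%N;
  prd_valA : forall c x, x \in VA -> edge x (prd c) -> lcA x = col c (FA alg);
  prd_valB : forall c x, x \in VB -> edge x (prd c) -> lcB x = col c (FB alg);
  out_val : forall i, lcC (out i) = row i (FC alg)
}.

Arguments edge {R ma mb mc r alg} e _ _.
Arguments inA {R ma mb mc r alg} e _.
Arguments inB {R ma mb mc r alg} e _.
Arguments out {R ma mb mc r alg} e _.

(** * Parallel schedules *)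

(* [Send q q' x] transfers the single element [x] from [q] to [q']; a longer
   message is several such events. *)
Inductive event (V : finType) (p : nat) :=
  | Compute of 'I_p & V
  | Send of 'I_p & 'I_p & V.

Section Schedule.

Variables (R : realType) (ma mb mc r : nat) (alg : bilinear_alg R ma mb mc r).
Variables (G : exec_dag alg) (p : nat).

(* The elements present on each processor. *)
Definition pstate := 'I_p -> {set G}.

Definition is_input (x : G) : bool :=
  (x \in codom (inA G)) || (x \in codom (inB G)).

Definition init_state (ownA : 'I_ma -> 'I_p) (ownB : 'I_mb -> 'I_p) : pstate :=
  fun q => [set inA G i | i : 'I_ma & ownA i == q]
       :|: [set inB G i | i : 'I_mb & ownB i == q].

Definition enabled (st : pstate) (e : event G p) : bool :=
  match e with
  | Compute q x => ~~ is_input x && ([set y | edge G y x] \subset st q)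
  | Send q q' x => (q != q') && (x \in st q)
  end.

Definition exec_event (st : pstate) (e : event G p) : pstate :=
  let: (q, x) := match e with
                 | Compute q x => (q, x)
                 | Send _ q' x => (q', x)
                 end in
  fun q' => if q' == q then x |: st q' else st q'.

Fixpoint valid_trace (st : pstate) (tr : seq (event G p)) : bool :=
  if tr is e :: tr' then enabled st e && valid_trace (exec_event st e) tr'
  else true.

Definition computes (x : G) (e : event G p) : bool :=
  if e is Compute _ y then y == x else false.

Definition sends (q : 'I_p) (e : event G p) : bool :=
  if e is Send q1 _ _ then q1 == q else false.

Definition receives (q : 'I_p) (e : event G p) : bool :=
  if e is Send _ q2 _ then q2 == q else false.

(* The trace is any causality-respecting linear order of the computations and
   transfers of a parallel execution.  Elements are never discarded, so copies
   of an output may remain elsewhere: its unique location at the end is the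
   one designated by [ownC]. *)
Record schedule := Schedule {
  ownA : 'I_ma -> 'I_p;
  ownB : 'I_mb -> 'I_p;
  ownC : 'I_mc -> 'I_p;
  trace : seq (event G p);
  trace_valid : valid_trace (init_state ownA ownB) trace;
  computed_once : forall x, ~~ is_input x -> count (computes x) trace = 1%N;
  outputs_stored : forall i,
    out G i \in foldl exec_event (init_state ownA ownB) trace (ownC i)
}.

Definition storage_balanced (S : schedule) : Prop :=
  forall q : 'I_p,
    [/\ (p * #|[set i | ownA S i == q]| = ma)%N,
        (p * #|[set i | ownB S i == q]| = mb)%N
      & (p * #|[set i | ownC S i == q]| = mc)%N].

Definition horizontal_cost (S : schedule) : nat :=
  \max_(q < p) (count (sends q) (trace S) + count (receives q) (trace S)).

End Schedule.

(* Main.v *)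
(* When one of s, t, v is zero, every column of each of the three matrices has
   a single nonzero entry, and one of the three tensors has the full order
   omega.  Fix a processor q, with cost W.  By a rank argument, at most W of
   the entries of a tensor stored on q take part in a product computed
   elsewhere, and the products computed on q touch at most W entries of a
   tensor that are not stored on q.  Hence for all but W of the N/p entries of
   the order-omega tensor stored on q, all products are computed on q; these
   products touch all the subtuples of length d = max(s,t,v) of the indices of
   such entries, and these belong to a set of at most M/p + W entries of the
   tensor of order d.  A discrete Loomis-Whitney inequality gives
   (N/p - W)^d <= (M/p + W)^omega, where N is of order n^omega and M <= n^d,
   and M/p is negligible for large p because d < omega. *)

Require Import Defs.
From HB Require Import structures.
From mathcomp Require Import all_boot all_order all_algebra.
From mathcomp Require Import reals exp.
From mathcomp Require Import lra.

Set Implicit Arguments.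
Unset Strict Implicit.
Unset Printing Implicit Defensive.

Import Order.TTheory GRing.Theory Num.Theory.
Local Open Scope ring_scope.

(** * Power inequalities over the naturals and the discrete Loomis-Whitney inequality *)

(** Over the reals this is the sum of [a <= b * K^(1/k)] and [a' <= b' * K^(1/k)]. To avoid roots,
    take [a/b <= a'/b'] without loss of generality; then [(a + a') * b' <= a' * (b + b')], and the
    hypothesis on [a'] suffices. *)
Lemma leq_exp_add (k a b a' b' K : nat) : (0 < k)%N ->
  (a ^ k <= b ^ k * K -> a' ^ k <= b' ^ k * K ->
   (a + a') ^ k <= (b + b') ^ k * K)%N.
Proof.
move=> k0; wlog le_ab : a b a' b' / (a * b' <= a' * b)%N => [H|] ha ha'.
  have [|/ltnW] := leqP (a * b') (a' * b); first by move=> /H; apply.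
  by move=> /H; rewrite addnC (addnC b); apply.
have [b'0|b'0] := posnP b'.
  move: ha'; rewrite b'0 exp0n // mul0n leqn0 expn_eq0 k0 andbT => /eqP ->.
  by rewrite !addn0.
have b'k : (0 < b' ^ k)%N by rewrite expn_gt0 b'0.
rewrite -(leq_pmul2r b'k) -expnMn.
apply: (@leq_trans ((a' * (b + b')) ^ k)).
  by rewrite leq_exp2r // mulnDl mulnDr leq_add2r.
by rewrite expnMn mulnC -mulnA leq_mul2l orbC mulnC ha'.
Qed.

Lemma leq_exp_sum (I : Type) (r : seq I) (k K : nat) (a b : I -> nat) :
  (0 < k)%N -> (forall i, a i ^ k <= b i ^ k * K)%N ->
  ((\sum_(i <- r) a i) ^ k <= (\sum_(i <- r) b i) ^ k * K)%N.
Proof.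
move=> k0 h; elim: r => [|i r IH]; first by rewrite !big_nil exp0n.
by rewrite !big_cons; exact: leq_exp_add.
Qed.

(** Weighted geometric mean of the two hypotheses, with weights [d.+1] and [m - d]: the exponents of
    [a] add up to [d.+1 * m], and an [m]-th root is then taken. *)
Lemma leq_exp_interpolate (a b e d m : nat) : (d < m)%N ->
  (a ^ d <= b ^ m -> a ^ d.+1 <= e ^ m ->
   a ^ d.+1 <= b ^ d.+1 * e ^ (m - d))%N.
Proof.
move=> lt_dm h1 h2; have m0 : (0 < m)%N by exact: leq_ltn_trans lt_dm.
rewrite -(leq_exp2r _ _ m0).
have -> : ((a ^ d.+1) ^ m = (a ^ d) ^ d.+1 * (a ^ d.+1) ^ (m - d))%N.
  by rewrite -!expnM -expnD -(mulnC d.+1) -mulnDr subnKC // ltnW.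
rewrite expnMn -(expnM b) -(expnM e) (mulnC d.+1) (mulnC (m - d)%N) !(expnM _ m).
by apply: leq_mul; rewrite leq_exp2r // subn_gt0.
Qed.

Lemma card_cons_split (T : finType) m (D : {set m.+1.-tuple T}) :
  #|D| = (\sum_x #|[set y : m.-tuple T | cons_tuple x y \in D]|)%N.
Proof.
rewrite -sum1_card (partition_big (fun y : m.+1.-tuple T => thead y) xpredT) //=.
apply: eq_bigr => x _; rewrite -sum1_card.
rewrite (reindex (fun y : m.-tuple T => cons_tuple x y)) /=.
  by apply: eq_bigl => y; rewrite inE theadE eqxx andbT.
exists (fun y : m.+1.-tuple T => behead_tuple y) => y; first by move=> _; apply: val_inj.
rewrite inE => /andP[_ /eqP <-]; apply: val_inj => /=.
by case: y => [[|a l] //=].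
Qed.

(* Discrete Loomis-Whitney inequality.  Slicing by the head [x], induction
   gives |Dx|^(d-1) <= |Ex|^(m-1) and |Dx|^d <= |E|^(m-1) for the slices;
   interpolating, |Dx| <= |Ex| |E|^((m-d)/d), which is summed over [x]. *)
Lemma card_subseq_closed (T : finType) m d (D : {set m.-tuple T})
    (E : {set d.-tuple T}) :
  (d <= m)%N -> D != set0 ->
  (forall (y : m.-tuple T) (z : d.-tuple T),
     y \in D -> subseq z y -> z \in E) ->
  (#|D| ^ d <= #|E| ^ m)%N.
Proof.
elim: m d D E => [|m IH] d D E.
  rewrite leqn0 => /eqP d0 _ _; subst d; by rewrite !expn0.
case: d E => [|d] E le_dm D0 DE.
  have /set0Pn[y Dy] := D0.
  rewrite expn0 expn_gt0 lt0n; apply/orP; left; rewrite cards_eq0.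
  by apply/set0Pn; exists [tuple]; apply: (DE y) => //; exact: sub0seq.
move: le_dm; rewrite ltnS leq_eqVlt => /orP[/eqP dm|lt_dm].
  subst d; rewrite leq_exp2r //; apply: subset_leq_card; apply/subsetP => y Dy.
  exact: (DE y).
(* The exponent [m.+1] is split as [d.+1 + (m - d)]. Only the first power of [#|E|] is sliced; the
   second is the constant [K] of [leq_exp_sum]. *)
rewrite -[in leqRHS](subnKC (leqW lt_dm)) subSS expnD.
rewrite (card_cons_split D) [in X in (_ <= X * _)%N](card_cons_split E).
apply: leq_exp_sum => // x.
set Dx := [set y | _ \in D]; set Ex := [set z | _ \in E].
have [->|Dx0] := eqVneq Dx set0; first by rewrite cards0 exp0n.
apply: leq_exp_interpolate => //; apply: IH => //; first exact: ltnW.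
(* Order [d] against the slice [Ex]: [x] is put in front of both tuples. Order [d.+1] against all of
   [E]: [x] is put in front of [y] only. *)
- by move=> y z; rewrite !inE => Dxy zy; apply: DE Dxy _; rewrite /= eqxx.
- move=> y z; rewrite inE => Dxy zy; apply: DE Dxy _.
  exact: subseq_trans zy (subseq_cons _ _).
Qed.

(** * Rank argument for the transfers into a set of processors *)

Section Flow.

Variables (R : realType) (ma mb mc r : nat) (alg : bilinear_alg R ma mb mc r).
Variables (G : exec_dag alg) (p : nat).

Implicit Types (st : pstate G p) (tr : seq (event G p)) (Q : {set 'I_p}).

Definition crossing Q (e : event G p) : bool :=
  if e is Send q1 q2 _ then (q1 \notin Q) && (q2 \in Q) else false.

Lemma exec_event_sub st e q : st q \subset exec_event st e q.
Proof.
rewrite /exec_event; case: e => [q1 x|q1 q2 x];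
  by case: ifP => // _; exact: subsetUr.
Qed.

Lemma trace_sub st tr q : st q \subset foldl (exec_event (p:=p)) st tr q.
Proof.
elim: tr st => //= e tr IH st.
exact: subset_trans (exec_event_sub _ _ _) (IH _).
Qed.

Definition compute_at (e : event G p) : option ('I_p * G) :=
  if e is Compute q x then Some (q, x) else None.

(** Elements are never discarded, so operands present when [x] is computed are still there at the
    end. *)
Lemma compute_operands st tr q x : valid_trace st tr ->
  has (fun e => compute_at e == Some (q, x)) tr ->
  [set y | edge G y x] \subset foldl (exec_event (p:=p)) st tr q.
Proof.
elim: tr st => //= e tr IH st /andP[en val_tr] /orP[|]; last exact: IH.
case: e en val_tr => //= q1 x1 /andP[_ sub] _ /eqP[<- <-].
apply: subset_trans sub _; apply: subset_trans (trace_sub _ tr _).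
exact: (exec_event_sub st (Compute q1 x1)).
Qed.

(* The values held by the processors in [Q] stay in the span of those that
   crossed into [Q], so the number of crossings bounds its dimension. *)
Lemma flow_span N (val : G -> 'rV[R]_N) Q tr : forall st (B : 'M[R]_N),
  valid_trace st tr ->
  (forall q x, q \in Q -> x \in st q -> (val x <= B)%MS) ->
  (forall q x (U : 'M[R]_N), q \in Q -> ~~ is_input x ->
     has (fun e => compute_at e == Some (q, x)) tr ->
     (forall y, edge G y x -> (val y <= U)%MS) -> (val x <= U)%MS) ->
  exists U : 'M[R]_N, (\rank U <= \rank B + count (crossing Q) tr)%N /\
    forall q x, q \in Q ->
      x \in foldl (exec_event (p:=p)) st tr q -> (val x <= U)%MS.
Proof.
elim: tr => [|e tr IH] st B /=; first by move=> _ hB _; exists B; rewrite addn0.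
move=> /andP[en val_tr] hB hC.
have hC' q x (U : 'M[R]_N) : q \in Q -> ~~ is_input x ->
    has (fun e => compute_at e == Some (q, x)) tr ->
    (forall y, edge G y x -> (val y <= U)%MS) -> (val x <= U)%MS.
  by move=> qQ nx hx; apply: hC qQ nx _; rewrite hx orbT.
have [cr|ncr] := boolP (crossing Q e).
- case: e en val_tr hC cr => //= q1 q2 z _ val_tr _ /andP[_ _].
  (* A crossing adds one row to the span, so the rank grows by at most one. *)
  have [|U [rU hU]] := IH _ (B + val z)%MS val_tr _ hC'.
  + move=> q x qQ; rewrite /exec_event; case: ifP => [_|_ xq].
      rewrite in_setU1 => /orP[/eqP ->|xq]; first exact: addsmxSr.
      by apply: submx_trans (hB _ _ qQ xq) _; exact: addsmxSl.
    by apply: submx_trans (hB _ _ qQ xq) _; exact: addsmxSl.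
  + exists U; split=> //; apply: leq_trans rU _.
    rewrite addnA leq_add2r.
    apply: leq_trans (mxrank_adds_leqif _ _) _.
    by rewrite leq_add2l rank_leq_row.
(* Other events keep [B]: a value computed in [Q] lies in every span containing its operands, and an
   element received in [Q] came from inside [Q]. *)
- rewrite add0n; apply: IH val_tr _ hC' => q x qQ.
  case: e en hC ncr => [q1 z|q1 q2 z] /=.
  + move=> /andP[nz sub] hC _; rewrite /exec_event; case: ifP => [/eqP qq1|_]; last exact: hB.
    rewrite in_setU1 => /orP[/eqP ->|]; last exact: hB.
    apply: (hC q1) => //; rewrite -?qq1 ?eqxx // => y yz.
    by apply: hB qQ _; rewrite qq1; apply: (subsetP sub); rewrite inE.
  + move=> /andP[_ zq1] _ ncr; rewrite /exec_event; case: ifP => [/eqP qq2|_]; last exact: hB.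
    rewrite in_setU1 => /orP[/eqP ->|]; last exact: hB.
    by apply: hB zq1; move: ncr; rewrite -qq2 qQ andbT negbK.
Qed.


Variable S : schedule G p.

Let init := @init_state _ _ _ _ _ _ G p (ownA S) (ownB S).
Let final := foldl (exec_event (p:=p)) init (trace S).

(** The span held by [Q] starts at dimension zero and ends by containing every basis vector up to
    scaling, hence has full rank [N]. *)
Lemma flow_dim N (val : G -> 'rV[R]_N) Q :
  (forall q x, q \in Q -> x \in init q -> val x = 0) ->
  (forall q x (U : 'M[R]_N), q \in Q -> ~~ is_input x ->
     has (fun e => compute_at e == Some (q, x)) (trace S) ->
     (forall y, edge G y x -> (val y <= U)%MS) -> (val x <= U)%MS) ->
  (forall j, exists q x a, [/\ q \in Q, x \in final q, a != 0 &
     val x = a *: delta_mx 0 j]) ->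
  (N <= count (crossing Q) (trace S))%N.
Proof.
move=> h0 hC hN.
have [|U []] := @flow_span N val Q (trace S) init 0 (trace_valid S) _ hC.
  by move=> q x qQ /(h0 _ _ qQ) ->; exact: sub0mx.
rewrite mxrank0 add0n => rU hU; apply: leq_trans rU.
suff /mxrankS : ((1%:M : 'M[R]_N) <= U)%MS by rewrite mxrank1.
apply/row_subP => j; rewrite rowE mulmx1.
have [q [x [a [qQ xq a0 vx]]]] := hN j.
by have := hU _ _ qQ xq; rewrite vx eqmx_scale.
Qed.

Lemma product_processor : exists pc : 'I_r -> 'I_p, forall c q,
  has (fun e => compute_at e == Some (q, prd G c)) (trace S) = (pc c == q).
Proof.
have once c : ~~ is_input (prd G c).
  apply/negP => /orP[] /codomP[i e].
  - have := disjointFr (VAC_disj G) (inA_VA G i).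
    by rewrite -e prd_VC.
  - have := disjointFr (VBC_disj G) (inB_VB G i).
    by rewrite -e prd_VC.
have ex c : exists q, has (fun e => compute_at e == Some (q, prd G c)) (trace S).
  have := computed_once S (once c) => h1.
  have : has (computes (prd G c)) (trace S) by rewrite has_count h1.
  elim: (trace S) => //= e tr IH /orP[|/IH[q hq]].
    case: e => //= q x /eqP ->; exists q; by rewrite eqxx.
  by exists q; rewrite hq orbT.
exists (fun c => xchoose (ex c)) => c q.
apply/idP/eqP => [hq|<-]; last exact: (xchooseP (ex c)).
move: (xchooseP (ex c)); set q' := xchoose _ => hq'; apply/eqP.
apply: contraTT isT => neq.
(* Computations of the product on two distinct processors are distinct events, so together they
   would exceed the single one allowed. *)
have : (count (fun e => compute_at e == Some (q', prd G c)) (trace S)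
  + count (fun e => compute_at e == Some (q, prd G c)) (trace S)
  <= count (computes (prd G c)) (trace S))%N.
  elim: (trace S) => //= e tr IH.
  rewrite addnACA; apply: leq_add IH.
  case: e => //= q1 x; rewrite !(inj_eq Some_inj) !xpair_eqE.
  case: (x == _); rewrite ?andbF ?andbT //.
  by case: eqP => [->|_]; rewrite ?(negbTE neq) ?leq_b1.
rewrite computed_once // leqNgt -addn1 leq_add //; rewrite ?addn0 -has_count //.
Qed.

Section Operand.

Variables (pc : 'I_r -> 'I_p) (Q : {set 'I_p}).
Hypothesis pcP : forall c q,
  has (fun e => compute_at e == Some (q, prd G c)) (trace S) = (pc c == q).

(** Coefficients are projected onto the counted entries, none of which [Q] owns. As a column of [F]
    has at most one nonzero, the operand of a product computed in [Q] projects to a multiple of a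
    basis vector, and each basis vector arises this way. *)
Lemma operand_flow m (VT : {set G}) (lc : G -> 'cV[R]_m) (own : 'I_m -> 'I_p)
    (F : 'M[R]_(m, r)) :
  (forall q x, x \in VT -> x \in init q ->
     exists2 i, own i = q & lc x = delta_mx i 0) ->
  (forall x, x \in VT -> ~~ is_input x ->
     lc x = \sum_(y | edge G y x) wt y x *: lc y) ->
  (forall x y, x \in VT -> edge G y x -> y \in VT) ->
  (forall c, exists x, [/\ x \in VT, edge G x (prd G c) & lc x = col c F]) ->
  (forall g g' c, F g c != 0 -> F g' c != 0 -> g = g') ->
  (#|[set g | (own g \notin Q) && [exists c, (pc c \in Q) && (F g c != 0%R)]]|
     <= count (crossing Q) (trace S))%N.
Proof.
move=> hin hadd hedge hop hF; set Z := [set g | _].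
(* The value zero outside [VT] makes transfers and computations of other kinds of vertices
   harmless. *)
pose val x : 'rV[R]_#|Z| :=
  if x \in VT then \row_j lc x (enum_val j) 0 else 0.
apply: (@flow_dim _ val).
- move=> q x qQ xq; rewrite /val; case: ifP => // xV.
  have [i oi ->] := hin _ _ xV xq; apply/rowP => j; rewrite !mxE eqxx andbT.
  case: eqP => // e; have := enum_valP j; rewrite inE e oi qQ //.
- move=> q x U qQ nx _ hU; rewrite /val; case: ifP => xV; last exact: sub0mx.
  have -> : \row_j lc x (enum_val j) 0 = \sum_(y | edge G y x) wt y x *: val y.
    rewrite hadd //; apply/rowP => j; rewrite mxE !summxE.
    by apply: eq_bigr => y yx; rewrite /val (hedge _ _ xV yx) !mxE.
  by apply: summx_sub => y yx; apply: scalemx_sub; exact: hU.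
- move=> j; have := enum_valP j; rewrite inE => /andP[_ /existsP[c /andP[cQ Fc]]].
  have [x [xV xc lx]] := hop c.
  exists (pc c), x, (F (enum_val j) c); split=> //.
    have hc : has (fun e => compute_at e == Some (pc c, prd G c)) (trace S).
      by rewrite pcP.
    by apply: (subsetP (compute_operands (trace_valid S) hc)); rewrite inE.
  rewrite /val xV lx; apply/rowP => j'; rewrite !mxE eqxx /=.
  have [->|ne] := eqVneq j' j; first by rewrite mulr1.
  rewrite mulr0; apply/eqP; apply: contraNT ne => Fc'.
  by apply/eqP/enum_val_inj; exact: hF Fc' Fc.
Qed.

Lemma edge_VA x y : x \in VA G -> edge G y x -> y \in VA G.
Proof.
move=> xA /edge_type; have xC := disjointFr (VAC_disj G) xA.
have xM : x \notin VM G.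
  by apply/imsetP => -[c _ e]; move: xC; rewrite e prd_VC.
rewrite !inE xC (disjointFr (VAB_disj G) xA) (negbTE xM) !andbF !orbF.
by case/andP.
Qed.

Lemma edge_VB x y : x \in VB G -> edge G y x -> y \in VB G.
Proof.
move=> xB /edge_type; have xC := disjointFr (VBC_disj G) xB.
have xM : x \notin VM G.
  by apply/imsetP => -[c _ e]; move: xC; rewrite e prd_VC.
rewrite !inE xC (disjointFl (VAB_disj G) xB) (negbTE xM) !andbF !orbF /=.
by case/andP.
Qed.

Lemma edge_VC x y : x \in VC G -> x \notin VM G -> edge G y x -> y \in VC G.
Proof.
move=> xC xM /edge_type.
rewrite (disjointFl (VAC_disj G) xC) (disjointFl (VBC_disj G) xC).
by rewrite (negbTE xM) !andbF /= => /andP[].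
Qed.

Lemma flow_A :
  (forall g g' c, FA alg g c != 0 -> FA alg g' c != 0 -> g = g') ->
  (#|[set g | (ownA S g \notin Q) &&
              [exists c, (pc c \in Q) && (FA alg g c != 0%R)]]|
     <= count (crossing Q) (trace S))%N.
Proof.
apply: (@operand_flow _ (VA G) (@lcA _ _ _ _ _ _ G)).
- move=> q x xA; rewrite inE => /orP[] /imsetP[i]; rewrite inE => /eqP oi e.
    by exists i => //; rewrite e lcA_in.
  by have := disjointFr (VAB_disj G) xA; rewrite e inB_VB.
- by move=> x xA /norP[nx _]; exact: lcA_add.
- exact: edge_VA.
- move=> c; have := prd_opA G c => h.
  have /card_gt0P[x] : (0 < #|[set x in VA G | edge G x (prd G c)]|)%N by rewrite h.
  by rewrite inE => /andP[xA xc]; exists x; split=> //; exact: prd_valA.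
Qed.

Lemma flow_B :
  (forall g g' c, FB alg g c != 0 -> FB alg g' c != 0 -> g = g') ->
  (#|[set g | (ownB S g \notin Q) &&
              [exists c, (pc c \in Q) && (FB alg g c != 0%R)]]|
     <= count (crossing Q) (trace S))%N.
Proof.
apply: (@operand_flow _ (VB G) (@lcB _ _ _ _ _ _ G)).
- move=> q x xB; rewrite inE => /orP[] /imsetP[i]; rewrite inE => /eqP oi e.
    by have := disjointFl (VAB_disj G) xB; rewrite e inA_VA.
  by exists i => //; rewrite e lcB_in.
- by move=> x xB /norP[_ nx]; exact: lcB_add.
- exact: edge_VB.
- move=> c; have := prd_opB G c => h.
  have /card_gt0P[x] : (0 < #|[set x in VB G | edge G x (prd G c)]|)%N by rewrite h.
  by rewrite inE => /andP[xB xc]; exists x; split=> //; exact: prd_valB.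
Qed.

(* Each output counted has a product computed outside [Q]; reading off the
   coefficients on these products kills the products computed inside [Q] and
   sends the outputs to multiples of distinct basis vectors. *)
Lemma flow_C :
  (forall g g' c, FC alg g c != 0 -> FC alg g' c != 0 -> g = g') ->
  (#|[set g | (ownC S g \in Q) &&
              [exists c, (pc c \notin Q) && (FC alg g c != 0%R)]]|
     <= count (crossing Q) (trace S))%N.
Proof.
move=> hF; set Z := [set g | _].
have exc (j : 'I_#|Z|) : exists c, (pc c \notin Q) && (FC alg (enum_val j) c != 0).
  by have := enum_valP j; rewrite inE => /andP[_ /existsP].
pose cc j := xchoose (exc j).
have ccP j : pc (cc j) \notin Q /\ FC alg (enum_val j) (cc j) != 0.
  exact/andP/(xchooseP (exc j)).
pose val x : 'rV[R]_#|Z| :=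
  if x \in VC G then \row_j lcC x 0 (cc j) else 0.
apply: (@flow_dim _ val).
- move=> q x qQ; rewrite /val inE => /orP[] /imsetP[i _ ->].
    by rewrite (disjointFr (VAC_disj G) (inA_VA G i)).
  by rewrite (disjointFr (VBC_disj G) (inB_VB G i)).
- move=> q x U qQ nx cx hU; rewrite /val; case: ifP => xC; last exact: sub0mx.
  have [/imsetP[c _ xc]|xM] := boolP (x \in VM G).
    move: cx; rewrite xc pcP => /eqP pcc; rewrite lcC_prd.
    rewrite [X in (X <= _)%MS](_ : _ = 0) ?sub0mx //.
    (* The chosen products [cc j] are computed outside [Q], so none of them is [c]. *)
    apply/rowP => j; rewrite !mxE /=; case: eqP => // e.
    by have [] := ccP j; rewrite e pcc qQ.
  have -> : \row_j lcC x 0 (cc j) = \sum_(y | edge G y x) wt y x *: val y.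
    rewrite lcC_add //; apply/rowP => j; rewrite mxE !summxE.
    by apply: eq_bigr => y yx; rewrite /val (edge_VC xC xM yx) !mxE.
  by apply: summx_sub => y yx; apply: scalemx_sub; exact: hU.
- move=> j; have := enum_valP j; rewrite inE => /andP[oQ _].
  exists (ownC S (enum_val j)), (out G (enum_val j)), (FC alg (enum_val j) (cc j)).
  split=> //; [exact: outputs_stored | exact: (ccP j).2 |].
  rewrite /val out_VC out_val; apply/rowP => j'; rewrite !mxE eqxx /=.
  have [->|ne] := eqVneq j' j; first by rewrite mulr1.
  rewrite mulr0; apply/eqP; apply: contraNT ne => Fc'.
  by apply/eqP/enum_val_inj; exact: hF (ccP j').2 Fc'.
Qed.

End Operand.

End Flow.

(** * Communication bounds for a single processor *)

(** The form is the same for operands and results, so each of the three tensors can serve as the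
    large or as the small one later. *)
Definition comm_bounded (R : realType) (m r p : nat) (F : 'M[R]_(m, r))
    (own : 'I_m -> 'I_p) (pc : 'I_r -> 'I_p) (q : 'I_p) (W : nat) : Prop :=
  (#|[set g | (own g == q) && [exists c, (pc c != q) && (F g c != 0%R)]]| <= W)%N /\
  (#|[set g | [exists c, (pc c == q) && (F g c != 0%R)]]|
     <= #|[set g | own g == q]| + W)%N.

Section CommBounded.

Variables (R : realType) (ma mb mc r : nat) (alg : bilinear_alg R ma mb mc r).
Variables (G : exec_dag alg) (p : nat) (S : schedule G p).
Variables (pc : 'I_r -> 'I_p) (q : 'I_p).

Lemma crossing_set1 :
  (count (crossing [set q]) (trace S) <= horizontal_cost S)%N.
Proof.
apply: leq_trans (leq_bigmax q); apply: leq_trans (leq_addl _ _).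
by apply: sub_count => -[q1 x|q1 q2 x] //=; rewrite !inE => /andP[].
Qed.

Lemma crossing_setC1 :
  (count (crossing (~: [set q])) (trace S) <= horizontal_cost S)%N.
Proof.
apply: leq_trans (leq_bigmax q); apply: leq_trans (leq_addr _ _).
by apply: sub_count => -[q1 x|q1 q2 x] //=; rewrite !inE negbK => /andP[].
Qed.

Lemma card_hit m (F : 'M[R]_(m, r)) (own : 'I_m -> 'I_p) W :
  (#|[set g | (own g != q) && [exists c, (pc c == q) && (F g c != 0%R)]]| <= W)%N ->
  (#|[set g | [exists c, (pc c == q) && (F g c != 0%R)]]|
     <= #|[set g | own g == q]| + W)%N.
Proof.
move=> h; set X := [set g | [exists c, _]]; set O := [set g | own g == q].
rewrite -(cardsID O X); apply: leq_add; first exact/subset_leq_card/subsetIr.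
by apply: leq_trans h; apply/subset_leq_card/subsetP => g; rewrite !inE.
Qed.

(** An entry owned by [q] and used elsewhere flows out of [q], giving [Q = ~: [set q]]; an entry
    used on [q] and owned elsewhere flows in, giving [Q = [set q]]. *)
Lemma comm_bounded_operand m (F : 'M[R]_(m, r)) (own : 'I_m -> 'I_p) :
  (forall Q : {set 'I_p}, (#|[set g | (own g \notin Q) &&
                [exists c, (pc c \in Q) && (F g c != 0%R)]]|
     <= count (crossing Q) (trace S))%N) ->
  comm_bounded F own pc q (horizontal_cost S).
Proof.
move=> h; split.
- apply: leq_trans crossing_setC1; apply: leq_trans (h _).
  apply/subset_leq_card/subsetP => g; rewrite !inE negbK => /andP[-> /existsP[c hc]].
  by apply/existsP; exists c; rewrite !inE.
- apply: card_hit; apply: leq_trans crossing_set1; apply: leq_trans (h _).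
  apply/subset_leq_card/subsetP => g; rewrite !inE => /andP[-> /existsP[c hc]].
  by apply/existsP; exists c; rewrite !inE.
Qed.

(** The directions are reversed: contributions flow from the products to the owner of the output. *)
Lemma comm_bounded_result m (F : 'M[R]_(m, r)) (own : 'I_m -> 'I_p) :
  (forall Q : {set 'I_p}, (#|[set g | (own g \in Q) &&
                [exists c, (pc c \notin Q) && (F g c != 0%R)]]|
     <= count (crossing Q) (trace S))%N) ->
  comm_bounded F own pc q (horizontal_cost S).
Proof.
move=> h; split.
- apply: leq_trans crossing_set1; apply: leq_trans (h _).
  apply/subset_leq_card/subsetP => g; rewrite !inE => /andP[-> /existsP[c hc]].
  by apply/existsP; exists c; rewrite !inE.
- apply: card_hit; apply: leq_trans crossing_setC1; apply: leq_trans (h _).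
  apply/subset_leq_card/subsetP => g; rewrite !inE => /andP[-> /existsP[c hc]].
  by apply/existsP; exists c; rewrite !inE negbK.
Qed.

End CommBounded.

(** * Isoperimetry, sizes of the index sets and the resulting numerical bound *)

Lemma comm_bounded_isoperimetry (R : realType) (n m d r p : nat)
    (F : 'M[R]_(#|sym_index n m|, r)) (F' : 'M[R]_(#|sym_index n d|, r))
    (own : 'I_#|sym_index n m| -> 'I_p) (own' : 'I_#|sym_index n d| -> 'I_p)
    (pc : 'I_r -> 'I_p) (q : 'I_p) (W : nat) :
  (0 < d <= m)%N ->
  (forall (g : sym_index n m) (z : sym_index n d), subseq (val z) (val g) ->
     exists c, F (enum_rank g) c != 0 /\ F' (enum_rank z) c != 0) ->
  comm_bounded F own pc q W -> comm_bounded F' own' pc q W ->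
  ((#|[set g | own g == q]| - W) ^ d <= (#|[set g | own' g == q]| + W) ^ m)%N.
Proof.
move=> /andP[d0 le_dm] link [bad _] [_ hit].
set O := [set g | own g == q] in bad *.
pose B := [set g | (own g == q) && [exists c, (pc c != q) && (F g c != 0%R)]].
(* [D] holds the owned tuples all of whose products are on [q], and [E] the tuples of order [d]
   touched by products on [q]. By [link], a tuple of [D] shares a product with each of its
   subtuples, so these lie in [E]. *)
pose D := [set val (enum_val g) | g in O :\: B].
pose H := [set g | [exists c, (pc c == q) && (F' g c != 0%R)]].
pose E := [set val (enum_val g) | g in H].
have le_OD : (#|O| - W <= #|D|)%N.
  rewrite card_imset; last by move=> x y /val_inj /enum_val_inj.
  rewrite leq_subLR addnC -(cardsID B O) addnC leq_add2l.
  by apply: leq_trans bad; apply/subset_leq_card/subsetIr.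
have le_E : (#|E| <= #|[set g | own' g == q]| + W)%N.
  by rewrite card_imset // => x y /val_inj /enum_val_inj.
have [D0|D0] := eqVneq D set0.
  move: le_OD; rewrite D0 cards0 leqn0 => /eqP ->.
  by rewrite exp0n.
have m0 : (0 < m)%N by exact: leq_trans le_dm.
apply: (@leq_trans (#|D| ^ d)); first by rewrite leq_exp2r.
apply: (@leq_trans (#|E| ^ m)); last by rewrite leq_exp2r.
apply: card_subseq_closed => // y z /imsetP[g gD ->] zg.
have sz : sorted leq [seq val i | i <- z].
  apply: (subseq_sorted leq_trans _ (valP (enum_val g))).
  exact: map_subseq.
pose z' : sym_index n d := Sub z sz.
have [c [Fc F'c]] := link (enum_val g) z' zg.
apply/imsetP; exists (enum_rank z'); last by rewrite enum_rankK.
rewrite inE; apply/existsP; exists c; rewrite F'c andbT.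
move: gD; rewrite !inE => /andP[nB oq]; move: nB.
rewrite oq /= negb_exists => /forallP /(_ c).
by move: Fc; rewrite enum_valK => ->; rewrite andbT negbK.
Qed.

(** A tuple is recovered from its sorted form and a map of positions. Since [index] returns first
    occurrences, that map need not be injective, whence the factor [d ^ d]. *)
Lemma expn_le_sym_index n d : (n ^ d <= #|sym_index n d| * d ^ d)%N.
Proof.
have [d0|d0] := posnP d.
  subst d; rewrite expn0 muln1; apply/card_gt0P.
  by exists (Sub [tuple] isT).
have -> : (n ^ d = #|{: d.-tuple 'I_n}|)%N by rewrite card_tuple card_ord.
have -> : (#|sym_index n d| * d ^ d = #|{: sym_index n d * {ffun 'I_d -> 'I_d}}|)%N.
  by rewrite card_prod card_ffun !card_ord.
pose f (x : sym_index n d * {ffun 'I_d -> 'I_d}) : d.-tuple 'I_n :=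
  [tuple tnth (val x.1) (x.2 i) | i < d].
have surj t : t \in codom f.
  pose l := sort (fun i j : 'I_n => (i <= j)%N) t.
  have sl : size l == d by rewrite size_sort size_tuple.
  have sortl : sorted leq [seq val i | i <- Tuple sl].
    by rewrite sorted_map; apply: sort_sorted => i j; exact: leq_total.
  have idx i : (index (tnth t i) l < d)%N.
    by rewrite -[X in (_ < X)%N](eqP sl) index_mem mem_sort mem_tnth.
  apply/codomP; exists (Sub (Tuple sl) sortl, [ffun i => Ordinal (idx i)]).
  apply: eq_from_tnth => i; rewrite tnth_mktuple ffunE /=.
  rewrite [RHS](tnth_nth (tnth t i)) /= nth_index //.
  by rewrite mem_sort mem_tnth.
have := leq_image_card f xpredT.
rewrite cardT /=; apply: leq_trans; apply/subset_leq_card/subsetP => t _.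
exact: surj.
Qed.

Lemma sym_index_le_expn n d : (#|sym_index n d| <= n ^ d)%N.
Proof.
have -> : (n ^ d = #|{: d.-tuple 'I_n}|)%N by rewrite card_tuple card_ord.
rewrite card_sub; exact: max_card.
Qed.

(** By contradiction, with [C = 2 * w ^ w]: if [2 * C * W < Y], then [W] is small against [X], so
    [X <= C * (oN - W)], and [key] gives [Y <= C * (oM + W)]. For large [p] also [2 * C * oM <= Y],
    so the right side is below [Y]. *)
Lemma exponent_arith (R : realType) (w d n p N M oN oM W : nat) :
  (0 < d < w)%N -> (0 < n)%N -> ((4 * w ^ w) ^ w <= p)%N ->
  (n ^ w <= N * w ^ w)%N -> (N <= n ^ w)%N -> (M <= n ^ d)%N ->
  (p * oN = N)%N -> (p * oM = M)%N ->
  ((oN - W) ^ d <= (oM + W) ^ w)%N ->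
  (4 * w ^ w)%:R^-1 * (n%:R ^+ w / p%:R) `^ (d%:R / w%:R) <= W%:R :> R.
Proof.
move=> /andP[d0 dw] n0 hp hN1 hN2 hM eN eM key.
have w0 : (0 < w)%N by exact: ltn_trans dw.
have ww0 : (0 < w ^ w)%N by rewrite expn_gt0 w0.
have p0 : (0 < p)%N by apply: leq_trans hp; rewrite expn_gt0 muln_gt0 ww0.
have pR : 0 < p%:R :> R by rewrite ltr0n.
set X : R := n%:R ^+ w / p%:R; set Y := X `^ _.
pose C : R := 2 * (w ^ w)%:R.
have C4 : (4 * w ^ w)%:R = 2 * C :> R by rewrite natrM /C; lra.
have C2 : 2 <= C by rewrite /C ler_peMr // ler1n.
have C0 : 0 < C by exact: lt_le_trans C2.
(* Exact balance forces [oN] to be at least 1, hence [X >= 1]; this is what makes [Y <= X], the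
   exponent [d / w] being below 1. *)
have oN0 : (0 < oN)%N.
  have : (0 < N)%N.
    by case: (posnP N) hN1 => // ->; rewrite mul0n leqn0 expn_eq0 eqn0Ngt n0.
  by rewrite -eN muln_gt0 p0.
have XoN : oN%:R <= X.
  by rewrite /X ler_pdivlMr // -natrX -natrM ler_nat mulnC eN.
have X1 : 1 <= X by apply: le_trans XoN; rewrite ler1n.
have X0 : 0 < X by exact: lt_le_trans X1.
have [Xge0 Cge0] : 0 <= X /\ 0 <= C by split; exact: ltW.
have oNX : X <= oN%:R * (w ^ w)%:R.
  rewrite /X ler_pdivrMr // -natrX -!natrM ler_nat (leq_trans hN1) // -eN.
  by rewrite mulnC mulnA mulnAC [(w ^ w * _)%N]mulnC.
have Yge0 : 0 <= Y by exact: powR_ge0.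
have Yw : Y ^+ w = X ^+ d.
  rewrite -!powR_mulrn // /Y -powRrM divfK // pnatr_eq0 -lt0n //.
have YX : Y <= X.
  rewrite -(@ler_pXn2r _ w) ?nnegrE // Yw.
  by apply: ler_weXn2l => //; exact: ltnW.
have C20 : 0 < 2 * C by lra.
rewrite C4 mulrC ler_pdivrMr // leNgt; apply/negP => WY.
have oNW : X <= C * (oN - W)%:R.
  have h : oN%:R * (w ^ w)%:R <= ((oN - W)%:R + W%:R) * (w ^ w)%:R :> R.
    by rewrite ler_wpM2r // -natrD ler_nat addnC -leq_subLR.
  by move: h WY; rewrite /C mulrDl; lra.
have YC : Y <= C * (oM + W)%:R.
  rewrite -(@ler_pXn2r _ w) ?nnegrE ?mulr_ge0 // Yw.
  apply: (@le_trans _ _ ((C * (oN - W)%:R) ^+ d)).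
    by apply: lerXn2r => //; rewrite nnegrE mulr_ge0.
  rewrite [leLHS]exprMn [leRHS]exprMn; apply: ler_pM; rewrite ?exprn_ge0 //.
    by apply: ler_weXn2l => //; [by apply: le_trans C2; rewrite ler1n | exact: ltnW].
  by rewrite -!natrX ler_nat.
(* After raising to the power [w], this is [(4 * w ^ w) ^ w * p ^ d <= p ^ w], which follows from
   the threshold on [p] and [d < w]. *)
have oMY : 2 * C * oM%:R <= Y.
  have h : (oM ^ w * p ^ w <= n ^ (w * d))%N.
    by rewrite -expnMn (mulnC oM) eM (mulnC w) expnM leq_exp2r.
  rewrite -(@ler_pXn2r _ w) ?nnegrE ?mulr_ge0 // Yw -C4.
  rewrite /X expr_div_n -exprM ler_pdivlMr ?exprn_gt0 // -!natrX -natrM -!natrX -natrM ler_nat.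
  rewrite expnMn; apply: leq_trans h.
  rewrite mulnAC mulnC leq_mul2l; apply/orP; right.
  apply: (@leq_trans (p ^ d.+1)); last by rewrite leq_pexp2l.
  by rewrite expnS leq_mul2r hp orbT.
have : C * (oM + W)%:R < Y by move: oMY WY; rewrite natrD mulrDr; lra.
by rewrite ltNge YC.
Qed.

(** The equation [d = e] lets an order appear as [s + 0] or [0 + t] in the matrix types and as [s]
    or [t] in the bound. *)
Lemma comm_lower_bound (R : realType) (n m d e r p : nat)
    (F : 'M[R]_(#|sym_index n m|, r)) (F' : 'M[R]_(#|sym_index n d|, r))
    (own : 'I_#|sym_index n m| -> 'I_p) (own' : 'I_#|sym_index n d| -> 'I_p)
    (pc : 'I_r -> 'I_p) (q : 'I_p) (W : nat) :
  d = e -> (0 < e < m)%N -> (0 < n)%N -> ((4 * m ^ m) ^ m <= p)%N ->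
  (p * #|[set g | own g == q]| = #|sym_index n m|)%N ->
  (p * #|[set g | own' g == q]| = #|sym_index n d|)%N ->
  (forall (g : sym_index n m) (z : sym_index n d), subseq (val z) (val g) ->
     exists c, F (enum_rank g) c != 0 /\ F' (enum_rank z) c != 0) ->
  comm_bounded F own pc q W -> comm_bounded F' own' pc q W ->
  (4 * m ^ m)%:R^-1 * (n%:R ^+ m / p%:R) `^ (e%:R / m%:R) <= W%:R :> R.
Proof.
move=> <- dm n0 hp bal bal' link cb cb'.
apply: (@exponent_arith R _ _ _ _ _ _ _ _ _ dm n0 hp (expn_le_sym_index n m) (sym_index_le_expn n m)
  (sym_index_le_expn n d) bal bal').
apply: comm_bounded_isoperimetry cb cb' => //.
by case/andP: dm => -> /ltnW.
Qed.

(** * Splittings of index tuples *)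

Lemma perm_mask_negb (T : eqType) (m : seq bool) (k : seq T) : size m = size k ->
  perm_eq k (mask m k ++ mask [seq ~~ b | b <- m] k).
Proof.
elim: k m => [|x k IH] [|[] m] //= [/IH h]; first by rewrite perm_cons.
apply: (@perm_trans _ (x :: (mask m k ++ mask [seq ~~ b | b <- m] k))).
  by rewrite perm_cons.
exact/permEl/(perm_catCA [:: x]).
Qed.

Lemma chi_perm (T : finType) q r (k : (q + r).-tuple T) x y :
  (x, y) \in chi k -> perm_eq k (x ++ y).
Proof.
rewrite inE => /existsP[m /andP[/eqP <- /eqP <-]] /=.
by apply: perm_mask_negb; rewrite !size_tuple.
Qed.

(** Both tuples are sorted rearrangements of [x ++ y]. Consequently every column of each matrix of
    [Psi] has at most one nonzero. *)
Lemma chi_inj n q r (g g' : sym_index n (q + r)) x y :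
  (x, y) \in chi (val g) -> (x, y) \in chi (val g') -> g = g'.
Proof.
move=> /chi_perm h /chi_perm h'; apply: val_inj; apply: val_inj.
apply: (inj_map val_inj); apply: (sorted_eq leq_trans anti_leq).
- exact: (valP g).
- exact: (valP g').
- by apply: perm_map; apply: perm_trans h _; rewrite perm_sym.
Qed.

Lemma sym_index_subseq n d (s : seq 'I_n) (z : seq 'I_n) :
  sorted leq [seq val i | i <- s] -> subseq z s -> size z = d ->
  exists z' : sym_index n d, val (val z') = z.
Proof.
move=> so zs /eqP sz.
have so' : sorted leq [seq val i | i <- Tuple sz].
  by apply: subseq_sorted so; [exact: leq_trans | exact: map_subseq].
by exists (Sub (Tuple sz) so').
Qed.

Lemma chi_left n q r (g : sym_index n (q + r)) (z : seq 'I_n) :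
  subseq z (val g) -> size z = q ->
  exists (x : sym_index n q) (y : sym_index n r),
    val (val x) = z /\ (val x, val y) \in chi (val g).
Proof.
move=> zg sz; have [m sm ez] := subseqP zg.
have [x ex] := sym_index_subseq (valP g) zg sz.
have [|y ey] := @sym_index_subseq n r (val g) (mask [seq ~~ b | b <- m] (val g))
  (valP g) (mask_subseq _ _).
  have /perm_size := perm_mask_negb sm.
  by rewrite size_cat -ez sz size_tuple => /addnI <-.
exists x, y; split=> //; rewrite inE; move: sm; rewrite size_tuple => /eqP sm.
by apply/existsP; exists (Tuple sm); rewrite /= ex ey ez !eqxx.
Qed.

Lemma chi_right n q r (g : sym_index n (q + r)) (z : seq 'I_n) :
  subseq z (val g) -> size z = r ->
  exists (x : sym_index n q) (y : sym_index n r),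
    val (val y) = z /\ (val x, val y) \in chi (val g).
Proof.
move=> zg sz; have [m sm ez] := subseqP zg.
have [y ey] := sym_index_subseq (valP g) zg sz.
have [|x ex] := @sym_index_subseq n q (val g) (mask [seq ~~ b | b <- m] (val g))
  (valP g) (mask_subseq _ _).
  have /perm_size := perm_mask_negb sm.
  by rewrite size_cat -ez sz size_tuple [RHS]addnC => /addIn <-.
exists x, y; split=> //; rewrite inE.
(* The mask of [z] selects the second component, while [chi] expects the mask of the first, hence
   the negation. *)
have sm' : size [seq ~~ b | b <- m] == (q + r)%N by rewrite size_map sm size_tuple.
apply/existsP; exists (Tuple sm').
by rewrite /= ex ey ez mapK ?eqxx //; exact: negbK.
Qed.

Lemma chi_nil_right n q (g : sym_index n (q + 0)) (x : sym_index n q)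
    (y : sym_index n 0) :
  val (val x) = val (val g) -> (val x, val y) \in chi (val g).
Proof.
move=> e; rewrite inE; apply/existsP; exists [tuple of nseq (q + 0) true].
rewrite map_nseq /= mask_false (tuple0 (val y)) eqxx andbT e.
by rewrite mask_true // size_tuple.
Qed.

Lemma chi_nil_left n r (g : sym_index n (0 + r)) (x : sym_index n 0)
    (y : sym_index n r) :
  val (val y) = val (val g) -> (val x, val y) \in chi (val g).
Proof.
move=> e; rewrite inE; apply/existsP; exists [tuple of nseq (0 + r) false].
rewrite map_nseq /= mask_false (tuple0 (val x)) eqxx e /=.
by rewrite mask_true // size_tuple.
Qed.

(** * Nonzero pattern of [Psi] and the three cases of the lower bound *)

Section PsiEntries.

Variables (R : realType) (n s t v : nat).

Lemma Psi_A_neq0 g c : (FA (Psi R n s t v) g c != 0) =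
  ((val (enum_val c).1.1, val (enum_val c).2) \in chi (val (enum_val g))).
Proof. by rewrite mxE; case: (enum_val c) => -[j l] k; rewrite pnatr_eq0 eqb0 negbK. Qed.

Lemma Psi_B_neq0 h c : (FB (Psi R n s t v) h c != 0) =
  ((val (enum_val c).2, val (enum_val c).1.2) \in chi (val (enum_val h))).
Proof. by rewrite mxE; case: (enum_val c) => -[j l] k; rewrite pnatr_eq0 eqb0 negbK. Qed.

Lemma Psi_C_neq0 i c : (FC (Psi R n s t v) i c != 0) =
  ((val (enum_val c).1.1, val (enum_val c).1.2) \in chi (val (enum_val i))).
Proof.
rewrite mxE; case: (enum_val c) => -[j l] k /=; case: ifP => _; last by rewrite eqxx.
rewrite !mulf_neq0 ?pnatr_eq0 -?lt0n ?fact_gt0 //.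
rewrite /rho invr_eq0 pnatr_eq0 -lt0n prodn_gt0 // => x; exact: fact_gt0.
Qed.

End PsiEntries.

(** One assignment [pc] serves all three tensors, so that their bounds can be combined. *)
Lemma schedule_comm_bounded (R : realType) (n s t v p : nat)
    (G : exec_dag (Psi R n s t v)) (S : schedule G p) (q : 'I_p) :
  exists pc : 'I_#|col_index n s t v| -> 'I_p,
    [/\ comm_bounded (FA (Psi R n s t v)) (ownA S) pc q (horizontal_cost S),
        comm_bounded (FB (Psi R n s t v)) (ownB S) pc q (horizontal_cost S)
      & comm_bounded (FC (Psi R n s t v)) (ownC S) pc q (horizontal_cost S)].
Proof.
have [pc pcP] := product_processor S; exists pc; split.
- apply: comm_bounded_operand => Q; apply: (flow_A Q pcP) => g g' c.
  by rewrite !Psi_A_neq0 => h h'; apply: enum_val_inj; exact: chi_inj h h'.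
- apply: comm_bounded_operand => Q; apply: (flow_B Q pcP) => g g' c.
  by rewrite !Psi_B_neq0 => h h'; apply: enum_val_inj; exact: chi_inj h h'.
- apply: comm_bounded_result => Q; apply: (flow_C Q pcP) => g g' c.
  by rewrite !Psi_C_neq0 => h h'; apply: enum_val_inj; exact: chi_inj h h'.
Qed.

Theorem theorem6p2 (R : realType) (s t v : nat)
    (one_zero : ((s == 0) + (t == 0) + (v == 0) = 1)%N) :
  exists (gamma : R) (n0 p0 : nat), 0 < gamma /\
    forall n p : nat, (n0 <= n)%N -> (p0 <= p)%N ->
      (p %| #|sym_index n (s + v)|)%N ->
      (p %| #|sym_index n (v + t)|)%N ->
      (p %| #|sym_index n (s + t)|)%N ->
      (p %| #|col_index n s t v|)%N ->
    forall (G : exec_dag (Psi R n s t v)) (S : schedule G p),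
      storage_balanced S ->
      gamma * (n%:R ^+ (s + t + v) / p%:R)
                `^ ((maxn (maxn s t) v)%:R / (s + t + v)%:R)
        <= (horizontal_cost S)%:R.
Proof.
set w := (s + t + v)%N.
have c0 : (0 < 4 * w ^ w)%N by rewrite muln_gt0 expn_gt0; case: (w).
exists (4 * w ^ w)%:R^-1, 1%N, ((4 * w ^ w) ^ w)%N.
split; first by rewrite invr_gt0 ltr0n.
move=> n p n0 hp _ _ _ _ G S bal.
have p0 : (0 < p)%N by apply: leq_trans hp; rewrite expn_gt0 c0.
(* The bound already holds for the traffic of one processor, and any choice will do. *)
pose q := Ordinal p0.
have [balA balB balC] := bal q.
have [pc [cA cB cC]] := schedule_comm_bounded S q.
have sizeq d (z : sym_index n d) : size (val z) = d by exact: size_tuple.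
(* The empty tuple fills the slot of order zero in the column triples. *)
have [nil _] : exists z : sym_index n 0, true by exists (Sub [tuple] isT).
have sz0 (d : nat) (z : sym_index n (d + 0)) : size (val z) = d.
  by rewrite size_tuple addn0.
(* If [v = 0], the result has full order; it is compared with [A] of order [s] or [B] of order [t],
   whichever order is larger. *)
have [v0|v0] := posnP v.
- subst v; have ew : w = (s + t)%N by rewrite /w addn0.
  rewrite ew maxn0 in hp *.
  have [s0 t0] : (0 < s)%N /\ (0 < t)%N by case: (s) (t) one_zero => [|?] [|?].
  have [le_ts|lt_st] := leqP t s.
  + apply: (@comm_lower_bound R n (s + t) (s + 0) s _ p _ _ _ _ pc q (horizontal_cost S)
      (addn0 s) _ n0 hp balC balA _ cC cA); first by rewrite s0 -[X in (X < _)%N]addn0 ltn_add2l.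
    move=> g z zg; have [j [l [ez gc]]] := chi_left zg (sz0 _ z).
    exists (enum_rank (j, l, nil)).
    rewrite Psi_C_neq0 Psi_A_neq0 !enum_rankK /=; split=> //.
    exact: chi_nil_right.
  + apply: (@comm_lower_bound R n (s + t) (0 + t) t _ p _ _ _ _ pc q (horizontal_cost S)
      (add0n t) _ n0 hp balC balB _ cC cB); first by rewrite t0 -[X in (X < _)%N]add0n ltn_add2r.
    move=> g z zg; have [j [l [ez gc]]] := chi_right zg (sizeq _ z).
    exists (enum_rank (j, l, nil)).
    rewrite Psi_C_neq0 Psi_B_neq0 !enum_rankK /=; split=> //.
    exact: chi_nil_left.
(* If [s = 0], [B] has full order and is compared with [A] of order [v] or the result of order
   [t]. *)
have [s0|s0] := posnP s.
- subst s; have ew : w = (v + t)%N by rewrite /w add0n addnC.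
  rewrite ew max0n in hp *.
  have t0 : (0 < t)%N by case: (t) v0 one_zero => [|?] //; case: (v).
  rewrite maxnC; have [le_tv|lt_vt] := leqP t v.
  + apply: (@comm_lower_bound R n (v + t) (0 + v) v _ p _ _ _ _ pc q (horizontal_cost S)
      (add0n v) _ n0 hp balB balA _ cB cA); first by rewrite v0 -[X in (X < _)%N]addn0 ltn_add2l.
    move=> g z zg; have [k [l [ez gc]]] := chi_left zg (sizeq _ z).
    exists (enum_rank (nil, l, k)).
    rewrite Psi_B_neq0 Psi_A_neq0 !enum_rankK /=; split=> //.
    exact: chi_nil_left.
  + apply: (@comm_lower_bound R n (v + t) (0 + t) t _ p _ _ _ _ pc q (horizontal_cost S)
      (add0n t) _ n0 hp balB balC _ cB cC); first by rewrite t0 -[X in (X < _)%N]add0n ltn_add2r.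
    move=> g z zg; have [k [l [ez gc]]] := chi_right zg (sizeq _ z).
    exists (enum_rank (nil, l, k)).
    rewrite Psi_B_neq0 Psi_C_neq0 !enum_rankK /=; split=> //.
    exact: chi_nil_left.
(* If [t = 0], [A] has full order and is compared with the result of order [s] or [B] of order
   [v]. *)
have t0 : t = 0%N by case: (t) (s) (v) s0 v0 one_zero => [|?] [|?] [|?].
subst t; have ew : w = (s + v)%N by rewrite /w addn0.
rewrite ew maxn0 in hp *.
have [le_vs|lt_sv] := leqP v s.
- apply: (@comm_lower_bound R n (s + v) (s + 0) s _ p _ _ _ _ pc q (horizontal_cost S)
    (addn0 s) _ n0 hp balA balC _ cA cC); first by rewrite s0 -[X in (X < _)%N]addn0 ltn_add2l.
  move=> g z zg; have [j [k [ez gc]]] := chi_left zg (sz0 _ z).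
  exists (enum_rank (j, nil, k)).
  rewrite Psi_A_neq0 Psi_C_neq0 !enum_rankK /=; split=> //.
  exact: chi_nil_right.
- apply: (@comm_lower_bound R n (s + v) (v + 0) v _ p _ _ _ _ pc q (horizontal_cost S)
    (addn0 v) _ n0 hp balA balB _ cA cB); first by rewrite v0 -[X in (X < _)%N]add0n ltn_add2r.
  move=> g z zg; have [j [k [ez gc]]] := chi_right zg (sz0 _ z).
  exists (enum_rank (j, nil, k)).
  rewrite Psi_A_neq0 Psi_B_neq0 !enum_rankK /=; split=> //.
  exact: chi_nil_right.
Qed.
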